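(* Let $p\ge 5$ be a prime and let $r$ be an integer with $1\le r\le p-1$ such that $4r+1$ is a quadratic non-residue modulo $p$. Then for all integers $n\ge 0$ and all integers $k\ge j\ge 0$, \[ a_{p(k-j)+(p-3),\;pk+p}(pn+r)\equiv 0 \pmod p. \]
   Context: For positive integers $r,s$, $a_{r,s}(n)$ denotes the number of multicolored partitions of $n$ in which each even part may appear in one of $r$ colors and each odd part may appear in one of $s$ colors (copies of the same part size in different colors are distinct), with $a_{r,s}(0)=1$. Equivalently, for $|q|<1$, $\sum_{n\ge0}a_{r,s}(n)q^n = f_2^{s-r}/f_1^{s}$, where $f_m=\prod_{i\ge1}(1-q^{mi})$. *)

(* Defs.v *)
From mathcomp Require Import all_boot.

Set Implicit Arguments.
Unset Strict Implicit.
Unset Printing Implicit Defensive.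

(* The coloured copies of the parts 1, ..., n: the index i : 'I_n stands for
   the part i.+1, available in s colours if odd and in r colours if even. *)
Definition colored_part (r s n : nat) : finType :=
  {i : 'I_n & 'I_(if odd i.+1 then s else r)}.

(* A multicoloured partition of n is given by the multiplicities of its
   coloured parts; parts and multiplicities are at most n. *)
Definition colored_partitions (r s n : nat)
    : {set {ffun colored_part r s n -> 'I_n.+1}} :=
  [set m : {ffun colored_part r s n -> 'I_n.+1}
    | \sum_(x : colored_part r s n) (tag x).+1 * m x == n].

Definition a (r s n : nat) : nat := #|colored_partitions r s n|.

Definition quadratic_nonresidue (p c : nat) : Prop :=
  coprime c p /\ ~ exists x : nat, x ^ 2 = c %[mod p].

(* Main.v *)
(* If p divides s and r + 3, the generating function f_2^(s - r) / f_1^s is,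
   modulo p, the product of f_2^3 and a series in q^p.  By Jacobi's identity
     f_2^3 = sum_j (-1)^j (2j + 1) q^(j (j + 1)),
   so a nonzero coefficient of q^n forces n = j (j + 1) mod p for some j, and
   then 4n + 1 = (2j + 1)^2 mod p is a square.

   Jacobi's identity comes from the finite triple product expressing
     (1 - z) prod_(1 <= i <= n) (q^i - z) (1 - z q^i)
   as a sum of terms q^e(k) [2n + 1, k] (- z)^k: pairing k = n - j with
   k = n + 1 + j exhibits the factor 1 - z in the sum as well; cancel it and
   put z = 1.  Power series are replaced by polynomials compared up to a given
   order. *)
Require Import Defs.
From mathcomp Require Import all_boot all_algebra.
From mathcomp Require Import zify ring.

Set Implicit Arguments.
Unset Strict Implicit.
Unset Printing Implicit Defensive.

Import GRing.Theory.
Local Open Scope ring_scope.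

Lemma big_ord_odd (T : Type) (idx : T) (op : Monoid.law idx) n (F : nat -> T) :
  \big[op/idx]_(i < n | odd i) F i = \big[op/idx]_(i < n./2) F i.*2.+1.
Proof.
elim: n => [|n IHn]; first by rewrite !big_ord0.
rewrite big_mkcond big_ord_recr -big_mkcond /= IHn uphalf_half.
case: ifP => [odd_n|_]; last by rewrite Monoid.mulm1.
by rewrite big_ord_recr /= -[n in F n]odd_double_half odd_n.
Qed.

Lemma sum_exp_pascal (R : comPzRingType) (c z : R) n (F G : nat -> R) :
    F n.+1 = 0 -> G 0%N = c * F 0%N ->
    (forall k, G k.+1 = c * F k.+1 + F k) ->
  (c + z) * (\sum_(k < n.+1) F k * z ^+ k) = \sum_(k < n.+2) G k * z ^+ k.
Proof.
move=> Fn0 G0 GS; rewrite [RHS]big_ord_recl /= G0.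
under [X in _ = _ + X]eq_bigr => k _ do rewrite GS mulrDl.
rewrite big_split /= [X in _ = _ + (X + _)]big_ord_recr /= Fn0.
rewrite mulr0 mul0r addr0.
rewrite addrA mulrDl !mulr_sumr; congr (_ + _).
  rewrite big_ord_recl mulrA; congr (_ + _).
  by apply: eq_bigr => k _; rewrite mulrA.
by apply: eq_bigr => k _; rewrite exprS mulrCA.
Qed.

Lemma coef_exp_pchar (R : comNzRingType) p (f : {poly R}) i :
  p \in [pchar R] -> ~~ (p %| i)%N -> (f ^+ p)`_i = 0.
Proof.
move=> pcharR ndvd; have pcharRX : p \in [pchar {poly R}] by rewrite pchar_poly.
rewrite -(pFrobenius_autE pcharRX) -[f]coefK poly_def rmorph_sum.
rewrite coef_sum big1 // => j _.
rewrite /= pFrobenius_autE exprZn coefZ -exprM coefXn.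
by case: eqP ndvd => [->|]; rewrite ?dvdn_mull ?mulr0.
Qed.

(* With truncated subtraction at most one of the two binomials is nonzero:
   for k = m + l their sum is l (l - 1) / 2, whatever the sign of l. *)
Definition triple_exponent (m k : nat) : nat :=
  'C(k - m, 2) + 'C(m.+1 - k, 2).

Lemma triple_exponentSS m k : triple_exponent m.+1 k.+1 = triple_exponent m k.
Proof. by rewrite /triple_exponent !subSS. Qed.

Lemma triple_exponentS m k :
  (m.+1 + triple_exponent m k.+1 = triple_exponent m k + k.+1)%N.
Proof.
rewrite /triple_exponent subSS.
have [/subnKC <-|/ltnW /subnKC <-] := leqP m k.
  move: (k - m)%N => l; rewrite -addnS !addKn binS bin1.
  by rewrite !(@bin_small (_ - _)); lia.
move: (m - k)%N => l; rewrite -addnS !addKn binS bin1.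
by rewrite !(@bin_small (_ - _)); lia.
Qed.

Lemma triple_exponent0 m : triple_exponent m 0 = 'C(m.+1, 2).
Proof. by rewrite /triple_exponent sub0n bin0n subn0. Qed.

Lemma triple_exponent0n k : triple_exponent 0 k = 'C(k, 2).
Proof. by rewrite /triple_exponent subn0 (@bin_small (1 - k)) ?addn0; lia. Qed.

Lemma triple_exponentB n j :
  (j <= n)%N -> triple_exponent n (n - j) = 'C(j.+1, 2).
Proof.
move=> le_jn; rewrite /triple_exponent subnAC subnn sub0n bin0n.
by rewrite subSn ?leq_subr // subKn.
Qed.

Lemma triple_exponentD n j : triple_exponent n (n.+1 + j) = 'C(j.+1, 2).
Proof.
by rewrite /triple_exponent subnDA subnn sub0n bin0n addn0 addSnnS addKn.
Qed.

Section QSeries.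

Variables (R : comPzRingType) (q : R).

Definition qpoch (a : R) (n : nat) : R := \prod_(i < n) (1 - a * q ^+ i).

Fixpoint qbin (n k : nat) {struct n} : R :=
  match n, k with
  | _, 0%N => 1
  | 0%N, _.+1 => 0
  | n'.+1, k'.+1 => qbin n' k' + q ^+ k * qbin n' k
  end.

Lemma qpochD a m n : qpoch a (m + n) = qpoch a m * qpoch (a * q ^+ m) n.
Proof.
rewrite /qpoch big_split_ord; congr (_ * _).
by apply: eq_bigr => i _; rewrite exprD mulrA.
Qed.

Lemma qpoch1 a : qpoch a 1 = 1 - a.
Proof. by rewrite /qpoch big_ord1 mulr1. Qed.

Lemma qpochS a n : qpoch a n.+1 = (1 - a) * qpoch (a * q) n.
Proof. by rewrite -add1n qpochD qpoch1. Qed.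

Lemma qpochSr a n : qpoch a n.+1 = qpoch a n * (1 - a * q ^+ n).
Proof. by rewrite -addn1 qpochD qpoch1. Qed.

Lemma qbin0 n : qbin n 0 = 1.
Proof. by case: n. Qed.

Lemma qbinS n k : qbin n.+1 k.+1 = qbin n k + q ^+ k.+1 * qbin n k.+1.
Proof. by []. Qed.

Lemma qbin_small n k : (n < k)%N -> qbin n k = 0.
Proof.
elim: n k => [|n IHn] [|k] // lt_nk.
by rewrite qbinS !IHn ?mulr0 ?addr0 // ltnW.
Qed.

Lemma qbinn n : qbin n n = 1.
Proof. by elim: n => // n IHn; rewrite qbinS IHn qbin_small // mulr0 addr0. Qed.

Lemma qbinSr k m :
  qbin (k + m).+1 k.+1 = q ^+ m * qbin (k + m) k + qbin (k + m) k.+1.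
Proof.
elim: k m => [|k IHk] m.
  elim: m => [|m IHm]; first by rewrite /= !mulr1 mulr0.
  rewrite !add0n in IHm *.
  by rewrite qbinS [in LHS]IHm qbinS !qbin0 !exprS expr0; ring.
elim: m => [|m IHm].
  by rewrite addn0 qbinS expr0 mul1r (@qbin_small k.+1 k.+2) // mulr0.
have IHkS := IHk m.+1; rewrite addnS -addSn in IHkS.
rewrite addnS qbinS [in LHS]IHkS [in LHS]IHm !(qbinS _ k.+1) (qbinS _ k).
by rewrite !exprS; ring.
Qed.

Lemma qbin_sym k m : qbin (k + m) k = qbin (k + m) m.
Proof.
elim: k m => [|k IHk] m; first by rewrite qbin0 qbinn.
elim: m => [|m IHm]; first by rewrite addn0 qbin0 qbinn.
by rewrite addSn qbinSr IHk [RHS]qbinS -(addSnnS k m) -IHm; ring.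
Qed.

Lemma qpoch_qbin k n : qpoch q k * qbin (k + n) k = qpoch (q ^+ n.+1) k.
Proof.
elim: k n => [|k IHk] n; first by rewrite qbin0 mulr1 /qpoch !big_ord0.
elim: n => [|n IHn]; first by rewrite addn0 qbinn mulr1.
rewrite (qpochS (q ^+ _)) -exprSr addSnnS in IHn.
rewrite addSn qbinS mulrDr mulrCA IHn !qpochSr mulrAC IHk.
by rewrite !exprS; ring.
Qed.

Lemma qbinomial_theorem z n :
  qpoch (- z) n = \sum_(k < n.+1) q ^+ 'C(k, 2) * qbin n k * z ^+ k.
Proof.
elim: n z => [|n IHn] z; first by rewrite /qpoch big_ord0 big_ord1 /= !mulr1.
pose F k := q ^+ 'C(k.+1, 2) * qbin n k.
have F0 : F n.+1 = 0 by rewrite /F qbin_small ?mulr0.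
pose G k := q ^+ 'C(k, 2) * qbin n.+1 k.
rewrite qpochS opprK mulNr IHn.
rewrite -(sum_exp_pascal (c := 1) (G := G) z F0); first last.
- move=> k; rewrite /G /F qbinS mulrDr addrC mulrA -exprD mul1r.
  by rewrite (binS k.+1) bin1.
- by rewrite /G /F !qbin0 mul1r.
congr (_ * _); apply: eq_bigr => k _.
by rewrite /F exprMn binS bin1 exprD; ring.
Qed.

Lemma finite_triple_product m n z :
  \prod_(i < m) (q ^+ i.+1 + z) * qpoch (- z) n
  = \sum_(k < (m + n).+1) q ^+ triple_exponent m k * qbin (m + n) k * z ^+ k.
Proof.
elim: m => [|m IHm].
  rewrite big_ord0 mul1r qbinomial_theorem.
  by apply: eq_bigr => k _; rewrite triple_exponent0n.
pose F l k := q ^+ triple_exponent l k * qbin (l + n) k.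
have F0 : F m (m + n).+1 = 0 by rewrite /F qbin_small ?mulr0.
rewrite big_ord_recr /= mulrAC mulrC IHm.
rewrite (sum_exp_pascal (G := F m.+1) _ F0) //.
  by rewrite /F !qbin0 !mulr1 -exprD !triple_exponent0 binS bin1 addnC.
move=> k; rewrite /F addSn qbinS triple_exponentSS mulrDr addrC !mulrA -!exprD.
by rewrite triple_exponentS.
Qed.

Lemma symmetric_triple_product n z :
  (1 - z) * \prod_(i < n) ((q ^+ i.+1 - z) * (1 - z * q ^+ i.+1))
  = (1 - z) * \sum_(j < n.+1) q ^+ 'C(j.+1, 2) * qbin (n + n.+1) (n - j)
                * ((- z) ^+ (n - j) * \sum_(i < j.*2.+1) z ^+ i).
Proof.
have -> : (1 - z) * \prod_(i < n) ((q ^+ i.+1 - z) * (1 - z * q ^+ i.+1))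
    = \prod_(i < n) (q ^+ i.+1 - z) * qpoch (- - z) n.+1.
  rewrite opprK qpochS mulrCA /qpoch big_split; congr (_ * (_ * _)).
  by apply: eq_bigr => i _; rewrite exprS mulrA.
rewrite finite_triple_product -[(n + n.+1).+1]addSn big_split_ord /=.
rewrite (reindex_inj rev_ord_inj) -big_split mulr_sumr.
apply: eq_bigr => j _ /=.
have le_jn : (j <= n)%N by rewrite -ltnS.
have -> : qbin (n + n.+1) (n.+1 + j) = qbin (n + n.+1) (n - j).
  by rewrite (_ : n + n.+1 = (n - j) + (n.+1 + j))%N ?qbin_sym //; lia.
rewrite subSS triple_exponentB // triple_exponentD.
have -> : (- z) ^+ (n.+1 + j) = - (z ^+ j.*2.+1 * (- z) ^+ (n - j)).
  rewrite (_ : n.+1 + j = j.*2.+1 + (n - j))%N ?exprD; last lia.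
  by rewrite exprNn -signr_odd /= odd_double mulN1r mulNr.
have geom : (1 - z) * \sum_(i < j.*2.+1) z ^+ i = 1 - z ^+ j.*2.+1.
  by rewrite -opprB mulNr -subrX1 opprB.
by rewrite mulrCA [(1 - z) * _]mulrCA geom; ring.
Qed.

End QSeries.

Lemma rmorph_qbin (R S : comPzRingType) (f : {rmorphism R -> S}) (q : R) n k :
  f (qbin q n k) = qbin (f q) n k.
Proof.
elim: n k => [|n IHn] [|k] /=; rewrite ?rmorph0 ?rmorph1 //.
by rewrite rmorphD rmorphM rmorphXn !IHn.
Qed.

Lemma finite_jacobi (R : comNzRingType) (q : R) n :
  qpoch q q n ^+ 2
  = \sum_(j < n.+1) (-1) ^+ j * j.*2.+1%:R * q ^+ 'C(j.+1, 2)
                    * qbin q (n + n.+1) (n - j).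
Proof.
(* The factor 1 - z is regular for an indeterminate z, but vanishes at z = 1. *)
have lreg_1subX : GRing.lreg (1 - 'X : {poly R}).
  by rewrite -opprB; apply/lregN/monic_lreg/monicXsubC.
pose at1 : {rmorphism {poly R} -> R} := horner_eval 1.
have at1X : at1 'X = 1 by apply: hornerX.
have at1q : at1 q%:P = q by apply: hornerC.
have /(congr1 at1) := lreg_1subX _ _ (symmetric_triple_product q%:P n 'X).
have -> : at1 (\prod_(i < n)
        ((q%:P ^+ i.+1 - 'X) * (1 - 'X * q%:P ^+ i.+1)))
    = (-1) ^+ n * qpoch q q n ^+ 2.
  rewrite rmorph_prod -[n in (-1) ^+ n]card_ord -prodr_const expr2 -!big_split.
  apply: eq_bigr => i _ /=.
  by rewrite rmorphM !rmorphB rmorphM rmorphXn rmorph1 at1X at1q exprS; ring.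
rewrite rmorph_sum => sumE; apply: (can_inj (signrMK n)).
rewrite sumE mulr_sumr; apply: eq_bigr => j _.
have at1_geom : at1 (\sum_(i < j.*2.+1) 'X ^+ i) = j.*2.+1%:R.
  rewrite rmorph_sum -[j.*2.+1 in RHS]card_ord -sumr_const.
  by apply: eq_bigr => i _; rewrite rmorphXn /= at1X expr1n.
have signE : (-1) ^+ n * (-1) ^+ j = (-1) ^+ (n - j) :> R.
  by rewrite -{1}(@subnK j n) -1?ltnS // exprD -mulrA -expr2 sqrr_sign mulr1.
rewrite !rmorphM !rmorphXn rmorphN rmorph_qbin at1X at1q at1_geom -signE.
by ring.
Qed.

Definition eq_upto (R : nzRingType) (m : nat) (f g : {poly R}) : Prop :=
  forall i, (i < m)%N -> f`_i = g`_i.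

Section Truncation.

Variable R : comNzRingType.
Implicit Types f g h : {poly R}.

Lemma eq_upto_leq m n f g : (n <= m)%N -> eq_upto m f g -> eq_upto n f g.
Proof. by move=> le_nm fg i lt_in; apply/fg/(leq_trans lt_in). Qed.

Lemma eq_uptoM m f1 g1 f2 g2 :
  eq_upto m f1 g1 -> eq_upto m f2 g2 -> eq_upto m (f1 * f2) (g1 * g2).
Proof.
move=> fg1 fg2 i lt_im; rewrite !coefM; apply: eq_bigr => j _.
by rewrite fg1 ?fg2 //; have := ltn_ord j; lia.
Qed.

Lemma eq_upto_mulr1 m f g h :
  eq_upto m f g -> eq_upto m h 1 -> eq_upto m (f * h) g.
Proof. by rewrite -[g in _ -> _ -> eq_upto _ _ g]mulr1; apply: eq_uptoM. Qed.

Lemma eq_uptoZ m c f g : eq_upto m f g -> eq_upto m (c *: f) (c *: g).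
Proof. by move=> fg i lt_im; rewrite !coefZ fg. Qed.

Lemma eq_upto_sum (I : finType) m (F G : I -> {poly R}) :
  (forall i, eq_upto m (F i) (G i)) -> eq_upto m (\sum_i F i) (\sum_i G i).
Proof.
by move=> FG l lt_lm; rewrite !coef_sum; apply: eq_bigr => i _; apply: FG.
Qed.

Lemma eq_upto_prod (I : finType) m (F G : I -> {poly R}) :
  (forall i, eq_upto m (F i) (G i)) -> eq_upto m (\prod_i F i) (\prod_i G i).
Proof. by move=> FG; elim/big_rec2: _ => // i f g _; apply: eq_uptoM. Qed.

Lemma eq_uptoX m f g e : eq_upto m f g -> eq_upto m (f ^+ e) (g ^+ e).
Proof.
by move=> fg; rewrite -(card_ord e) -!prodr_const; apply: eq_upto_prod.
Qed.

Lemma eq_upto_XnM m d f g :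
  eq_upto m f g -> eq_upto (d + m) ('X^d * f) ('X^d * g).
Proof.
move=> fg i lt_i; rewrite !coefXnM; case: ltnP => // le_di.
by apply: fg; rewrite ltn_subLR.
Qed.

Lemma eq_upto_1subXn m d : (m <= d)%N -> eq_upto m (1 - 'X^d : {poly R}) 1.
Proof.
move=> le_md i lt_im.
by rewrite coefB coefXn ltn_eqF ?subr0 // (leq_trans lt_im).
Qed.

Lemma eq_upto_qpoch1 m d e n :
  (m <= e)%N -> eq_upto m (qpoch ('X^d : {poly R}) 'X^e n) 1.
Proof.
move=> le_me; rewrite /qpoch; elim/big_rec: _ => // i f _ f1.
rewrite mulrC; apply: eq_upto_mulr1 => //; rewrite -exprM -exprD.
by apply: eq_upto_1subXn; rewrite (leq_trans le_me) ?leq_addr.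
Qed.

Lemma eq_upto_qpoch_qbin d j k l : (k <= l)%N ->
  eq_upto (d * k.+1)
    (qpoch ('X^d : {poly R}) 'X^d (k + j) * qbin 'X^d (k + l) k) 1.
Proof.
move=> le_kl; rewrite qpochD mulrAC qpoch_qbin -exprS -!exprM.
by apply: eq_upto_mulr1; apply: eq_upto_qpoch1; rewrite leq_mul.
Qed.

Theorem jacobi_cube d n :
  eq_upto (d * n.+1) (qpoch ('X^d : {poly R}) 'X^d n ^+ 3)
    (\sum_(j < n.+1) ((-1) ^+ j * j.*2.+1%:R) *: 'X^(d * 'C(j.+1, 2))).
Proof.
rewrite exprS finite_jacobi mulr_sumr; apply: eq_upto_sum => j.
have le_jn : (j <= n)%N by rewrite -ltnS.
pose c : R := (-1) ^+ j * j.*2.+1%:R.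
have cE : (-1) ^+ j * j.*2.+1%:R = c%:P.
  by rewrite rmorphM rmorph_sign rmorph_nat.
have -> : qpoch 'X^d 'X^d n * ((-1) ^+ j * j.*2.+1%:R * 'X^d ^+ 'C(j.+1, 2)
              * qbin 'X^d (n + n.+1) (n - j))
    = c *: ('X^(d * 'C(j.+1, 2)) * (qpoch 'X^d 'X^d (n - j + j)
              * qbin 'X^d (n - j + (j + n.+1)) (n - j))).
  by rewrite subnK // addnA subnK // -mul_polyC -cE exprM; ring.
have le_nk : (n - j <= j + n.+1)%N by lia.
apply: eq_uptoZ; rewrite -[X in eq_upto _ _ X]mulr1.
apply: eq_upto_leq _ (eq_upto_XnM (eq_upto_qpoch_qbin _ le_nk)).
by rewrite -mulnDr leq_mul // binS bin1; lia.
Qed.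

Lemma coef_qpochX2_cube n i : (i <= n)%N ->
    (qpoch ('X^2 : {poly R}) 'X^2 n./2 ^+ 3)`_i != 0 ->
  exists j, i = (j * j.+1)%N.
Proof.
move=> le_in; rewrite jacobi_cube; last lia.
have [/existsP[j /eqP <-] _|] :=
  boolP [exists j : 'I_(n./2).+1, 2 * 'C(j.+1, 2) == i]%N.
  by exists j; rewrite -mul_bin_diag bin1 mulnC.
move=> /existsPn no_j; rewrite coef_sum big1 ?eqxx // => j _.
by rewrite coefZ coefXn eq_sym (negPf (no_j j)) mulr0.
Qed.

End Truncation.

Definition trunc_geom (R : nzRingType) (n d : nat) : {poly R} :=
  \sum_(m < n.+1) 'X^(d * m).

Definition colored_gf (R : comNzRingType) (r s n : nat) : {poly R} :=
  \prod_(i < n) trunc_geom R n i.+1 ^+ (if odd i.+1 then s else r).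

Section ColoredPartitions.

Variable R : comNzRingType.

Lemma trunc_geomM n d : (0 < d)%N ->
  eq_upto n.+1 (trunc_geom R n d * (1 - 'X^d)) 1.
Proof.
move=> d_gt0.
have -> : trunc_geom R n d * (1 - 'X^d) = 1 - 'X^(d * n.+1).
  rewrite -[in RHS]opprB exprM subrX1 mulrC -mulNr opprB; congr (_ * _).
  by apply: eq_bigr => i _; rewrite exprM.
by apply: eq_upto_1subXn; rewrite leq_pmull.
Qed.

Lemma coef_colored_gf r s n : (colored_gf R r s n)`_n = (a r s n)%:R.
Proof.
have -> : colored_gf R r s n
    = \prod_(x : colored_part r s n) \sum_(m < n.+1) 'X^((tag x).+1 * m).
  rewrite -(sig_big_dep xpredT (fun _ => xpredT)
    (fun (i : 'I_n) (_ : 'I_(if odd i.+1 then s else r)) =>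
       trunc_geom R n i.+1)) /=.
  by apply: eq_bigr => i _; rewrite prodr_const card_ord.
rewrite bigA_distr_bigA /= coef_sum /a -sum1_card natr_sum [RHS]big_mkcond /=.
apply: eq_bigr => m _; rewrite prodrXr coefXn inE eq_sym.
by case: eqP.
Qed.

Lemma colored_gfX e r s n :
  colored_gf R r s n ^+ e = colored_gf R (r * e) (s * e) n.
Proof.
rewrite /colored_gf -prodrXl; apply: eq_bigr => i _.
by rewrite -exprM; case: ifP.
Qed.

Lemma colored_gf_mul_qpoch t r s n :
  eq_upto n.+1
    (colored_gf R (r + t) s n * qpoch 'X^2 'X^2 n./2 ^+ t) (colored_gf R r s n).
Proof.
have -> : qpoch 'X^2 'X^2 n./2
    = \prod_(i < n | odd i) (1 - 'X^(i.+1)) :> {poly R}.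
  rewrite (big_ord_odd _ _ (fun i => 1 - 'X^(i.+1))); apply: eq_bigr => i _.
  by rewrite -exprM -exprD -mulnS -muln2 mulnC.
rewrite [\prod_(i < n | _) _]big_mkcond -prodrXl -big_split.
apply: eq_upto_prod => i /=; case: (odd i); last by rewrite expr1n mulr1.
rewrite exprD -mulrA -exprMn; apply: eq_upto_mulr1 => //.
rewrite -[X in eq_upto _ _ X](expr1n _ t).
by apply: eq_uptoX; apply: trunc_geomM.
Qed.

End ColoredPartitions.

Theorem dvdn_a_nonsquare p r s n :
    prime p -> (p %| s)%N -> (p %| r + 3)%N ->
    ~ (exists x : nat, x ^ 2 = 4 * n + 1 %[mod p])%N ->
  (p %| a r s n)%N.
Proof.
move=> p_prime /dvdnP[s' ->] /dvdnP[r' r3E] nonsquare.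
have pcharF : p \in [pchar 'F_p] := pchar_Fp p_prime.
rewrite (dvdn_pcharf pcharF) -coef_colored_gf -(colored_gf_mul_qpoch _ 3) //.
rewrite r3E -colored_gfX coefM big1 // => i _.
have [p_dvd_i|p_ndvd_i] := boolP (p %| i)%N; last first.
  by rewrite (coef_exp_pchar _ pcharF) ?mul0r.
apply/eqP; apply: contra_notT nonsquare; rewrite mulf_eq0 negb_or.
case/andP=> _ /coef_qpochX2_cube[|j jE]; first exact: leq_subr.
exists j.*2.+1.
have -> : (4 * n + 1 = 4 * i + j.*2.+1 ^ 2)%N.
  by have := ltn_ord i; rewrite -mulnn; lia.
by rewrite -modnDml -modnMmr (eqP p_dvd_i) muln0 mod0n.
Qed.

Local Close Scope ring_scope.

Theorem theorem1p13 (p r : nat) (p_prime : prime p) (p_ge5 : 5 <= p)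
    (r_bounds : 1 <= r <= p - 1)
    (r_nonres : quadratic_nonresidue p (4 * r + 1)) :
  forall n k j : nat, j <= k ->
    a (p * (k - j) + (p - 3)) (p * k + p) (p * n + r) = 0 %[mod p].
Proof.
move=> n k j _; have [_ r_nonsquare] := r_nonres.
apply/eqP; rewrite mod0n; apply: dvdn_a_nonsquare => //.
- by rewrite dvdn_add ?dvdn_mulr.
- by rewrite -addnA subnK ?dvdn_add ?dvdn_mulr // (leq_trans _ p_ge5).
case=> x xE; apply: r_nonsquare; exists x.
by rewrite xE mulnDr -addnA mulnCA -modnDml modnMr.
Qed.
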